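(* Let $K,T\subset\mathbb{R}^n$ be convex bodies, where $T$ is strictly convex and smooth. Let $q=(q_1,\dots,q_m)$ be an $\ell_T$-minimizing closed $(K,T)$-Minkowski billiard trajectory which fulfills the Minkowski billiard reflection rule with respect to $K$-supporting hyperplanes $H_1,\dots,H_m$, and let $U$ be the convex cone spanned by the outer unit vectors $n_K(q_1),\dots,n_K(q_m)$ normal to $H_1,\dots,H_m$. Then $U$ is a linear subspace of $\mathbb{R}^n$ with $\dim U=m-1$ (in particular $m\le n+1$), and $\dim(N_K(q_j)\cap U)=1$ for all $j\in\{1,\dots,m\}$.
   Context: A convex body in $\mathbb{R}^n$ is a compact convex set containing the origin in its interior. A convex body is smooth if through each boundary point there is a unique supporting hyperplane. For a convex body $T$, $T^\circ$ is its polar body and $\mu_{T^\circ}(x)=\min\{t\ge 0: x\in tT^\circ\}$ (it equals $h_T(x)=\max_{y\in T}\langle x,y\rangle$). For a convex set $C$ and $z\in\partial C$, $N_C(z)=\{v:\langle v,y-z\rangle\le 0\ \forall y\in C\}$ is the outer normal cone; the dimension of a convex cone is that of its linear span. A closed polygonal curve $(q_1,\dots,q_m)$, $m\ge2$, always satisfies $q_j\ne q_{j+1}$ and $q_j\notin[q_{j-1},q_{j+1}]$ (indices mod $m$); its $\ell_T$-length is $\ell_T(q)=\sum_j\mu_{T^\circ}(q_{j+1}-q_j)$. A closed polygonal curve $q=(q_1,\dots,q_m)$ with vertices on $\partial K$ is a closed $(K,T)$-Minkowski billiard trajectory if there are $p_1,\dots,p_m\in\partial T$ with $q_{j+1}-q_j\in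 N_T(p_j)$ and $p_{j+1}-p_j\in -N_K(q_{j+1})$ for all $j$; it fulfills the reflection rule with respect to the $K$-supporting hyperplanes $H_1,\dots,H_m$ through $q_1,\dots,q_m$ if there are outer unit normals $n_K(q_j)\in N_K(q_j)$ normal to $H_j$ and $\mu_j\ge0$ with $p_{j+1}-p_j=-\mu_{j+1}n_K(q_{j+1})$ for all $j$. Such a trajectory is $\ell_T$-minimizing if its $\ell_T$-length is minimal among all closed $(K,T)$-Minkowski billiard trajectories. *)

(* Defs.v *)
From HB Require Import structures.
From mathcomp Require Import all_boot all_order all_algebra.
From mathcomp Require Import all_classical all_reals all_analysis.
Set Implicit Arguments. Unset Strict Implicit. Unset Printing Implicit Defensive.
Import Order.TTheory GRing.Theory Num.Theory.
Import numFieldNormedType.Exports.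
Local Open Scope classical_set_scope.
Local Open Scope ring_scope.

Section Billiards.
Variables (R : realType) (n : nat).
Local Notation vec := 'rV[R]_n.

Definition dot (u v : vec) : R := \sum_(i < n) u ord0 i * v ord0 i.

Definition convex_setR (C : set vec) : Prop :=
  forall x y t, C x -> C y -> 0 <= t <= 1 -> C (t *: x + (1 - t) *: y).

Definition convex_body (C : set vec) : Prop :=
  compact C /\ convex_setR C /\ (interior C) 0.

Definition bd (C : set vec) : set vec := closure C `\` interior C.

Definition normal_cone (C : set vec) (z : vec) : set vec :=
  [set v | forall y, C y -> dot v (y - z) <= 0].

Definition supporting_hyperplane (C : set vec) (z : vec) (H : set vec) : Prop :=
  exists v, v != 0 /\ normal_cone C z v /\ H = [set x | dot v x = dot v z].

Definition smooth_body (C : set vec) : Prop :=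
  forall z, bd C z ->
    (exists H, supporting_hyperplane C z H) /\
    (forall H1 H2, supporting_hyperplane C z H1 ->
                   supporting_hyperplane C z H2 -> H1 = H2).

Definition strictly_convex (C : set vec) : Prop :=
  forall x y t, C x -> C y -> x != y -> 0 < t < 1 ->
    (interior C) (t *: x + (1 - t) *: y).

Definition polar (C : set vec) : set vec :=
  [set y | forall x, C x -> dot x y <= 1].

Definition gauge_polar (T : set vec) (x : vec) : R :=
  inf [set t : R | 0 <= t /\ exists y, polar T y /\ x = t *: y].

Definition cyc_succ (m : nat) (j : 'I_m) : 'I_m := ordS j.
Definition cyc_pred (m : nat) (j : 'I_m) : 'I_m := ord_pred j.

Definition segment (a b : vec) : set vec :=
  [set x | exists t, 0 <= t <= 1 /\ x = t *: a + (1 - t) *: b].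

Definition closed_polygon (m : nat) (q : 'I_m -> vec) : Prop :=
  (2 <= m)%N /\
  forall j : 'I_m, q j != q (cyc_succ j) /\
    ~ segment (q (cyc_pred j)) (q (cyc_succ j)) (q j).

Definition ellT (T : set vec) (m : nat) (q : 'I_m -> vec) : R :=
  \sum_(j < m) gauge_polar T (q (cyc_succ j) - q j).

Definition billiard_witness (K T : set vec) (m : nat) (q p : 'I_m -> vec) : Prop :=
  forall j : 'I_m, bd T (p j) /\
    normal_cone T (p j) (q (cyc_succ j) - q j) /\
    normal_cone K (q (cyc_succ j)) (- (p (cyc_succ j) - p j)).

Definition billiard_traj (K T : set vec) (m : nat) (q : 'I_m -> vec) : Prop :=
  closed_polygon q /\ (forall j, bd K (q j)) /\
  exists p, billiard_witness K T q p.

Definition ellT_minimizing (K T : set vec) (m : nat) (q : 'I_m -> vec) : Prop :=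
  billiard_traj K T q /\
  forall (m' : nat) (q' : 'I_m' -> vec), billiard_traj K T q' -> ellT T q <= ellT T q'.

Definition cone_span (m : nat) (v : 'I_m -> vec) : set vec :=
  [set x | exists lam : 'I_m -> R, (forall j, 0 <= lam j) /\ x = \sum_(j < m) lam j *: v j].

Definition linear_subspace (U : set vec) : Prop :=
  U 0 /\ (forall x y, U x -> U y -> U (x + y)) /\ (forall (a : R) x, U x -> U (a *: x)).

Definition span_dim (C : set vec) (k : nat) : Prop :=
  exists v : 'I_k -> vec, (forall i, C (v i)) /\
    row_free (\matrix_(i < k) v i) /\
    (forall x, C x -> (x <= \matrix_(i < k) v i)%MS).

End Billiards.

(* Main.v *)
Require Import Defs.
From HB Require Import structures.
From mathcomp Require Import all_boot all_order all_algebra.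
From mathcomp Require Import all_classical all_reals all_analysis.
From mathcomp Require Import ring lra.
Set Implicit Arguments. Unset Strict Implicit. Unset Printing Implicit Defensive.
Import Order.TTheory GRing.Theory Num.Theory.
Import numFieldNormedType.Exports.
Local Open Scope classical_set_scope.
Local Open Scope ring_scope.

(* The heart of the matter is a rigidity statement: if [v_j] lies in [N_K(q_j)],
   [sum_j v_j = 0] and [v] is not identically zero, then [v] is proportional to the
   family [p_(j-1) - p_j = mu_j n_K(q_j)], all of whose members are nonzero by
   smoothness of [T].  Applied to [v_j = lambda_j n_K(q_j)] it says that the positive
   relation [sum_j mu_j n_K(q_j) = 0] is the only linear relation between the normals,
   so that the cone is a subspace of dimension [m - 1]; applied to a modification of one
   [v_j] by an element of [N_K(q_j) `&` U] it shows that this set is contained in a line.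

   Rigidity is a Lagrange multiplier rule.  Call [v] a certificate if [sum_j v_j = 0]
   and [sum_j <v_j, k_j> <= 1] for all [k_j] in [K]; a closed curve [q'] with
   [sum_j <v_j, q'_j> >= 1] is then at least as long as some billiard trajectory.
   Indeed, for a fixed number of vertices a shortest curve admitting some certificate
   exists by compactness.  If one of its vertices lies on the segment between its
   neighbours, delete it and use induction.  Otherwise [h_T] is differentiable at the
   edges by strict convexity of [T], the multiplier rule yields the vertices [p_j], and
   projecting onto [K ^ m] (separation) shows that some translate of the curve has its
   vertices in [K]: else it could be shrunk.  Hence a minimizing trajectory [q] minimizes
   the length subject to the linear constraint given by any normalized [v] as above. *)

(** * Inner product, maximum norm and continuity *)

Section Dot.
Variables (R : realType) (n : nat).
Implicit Types (x y z : 'rV[R]_n) (a : R).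

Lemma dotC x y : dot x y = dot y x.
Proof. by apply: eq_bigr => i _; rewrite mulrC. Qed.

Lemma dotDl x y z : dot (x + y) z = dot x z + dot y z.
Proof. by rewrite -big_split /=; apply: eq_bigr => i _; rewrite mxE mulrDl. Qed.

Lemma dotZl a x y : dot (a *: x) y = a * dot x y.
Proof. by rewrite big_distrr /=; apply: eq_bigr => i _; rewrite mxE mulrA. Qed.

Lemma dotNl x y : dot (- x) y = - dot x y.
Proof. by rewrite -scaleN1r dotZl mulN1r. Qed.

Lemma dotBl x y z : dot (x - y) z = dot x z - dot y z.
Proof. by rewrite dotDl dotNl. Qed.

Lemma dot0l x : dot 0 x = 0.
Proof. by rewrite -(scale0r x) dotZl mul0r. Qed.

Lemma dotDr x y z : dot x (y + z) = dot x y + dot x z.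
Proof. by rewrite dotC dotDl !(dotC x). Qed.

Lemma dotZr a x y : dot x (a *: y) = a * dot x y.
Proof. by rewrite dotC dotZl dotC. Qed.

Lemma dotNr x y : dot x (- y) = - dot x y.
Proof. by rewrite dotC dotNl dotC. Qed.

Lemma dotBr x y z : dot x (y - z) = dot x y - dot x z.
Proof. by rewrite dotDr dotNr. Qed.

Lemma dot0r x : dot x 0 = 0.
Proof. by rewrite dotC dot0l. Qed.

Lemma dot_suml I (r : seq I) (P : pred I) (F : I -> 'rV[R]_n) x :
  dot (\sum_(i <- r | P i) F i) x = \sum_(i <- r | P i) dot (F i) x.
Proof.
by elim/big_rec2: _ => [|i y z _ <-]; [exact: dot0l | rewrite dotDl].
Qed.

Lemma dot_ge0 x : 0 <= dot x x.
Proof. by apply: sumr_ge0 => i _; rewrite -expr2 sqr_ge0. Qed.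

Lemma dot_eq0 x : dot x x = 0 -> x = 0.
Proof.
move=> /eqP; rewrite psumr_eq0 => [/allP x0|i _]; last by rewrite -expr2 sqr_ge0.
apply/rowP => i; rewrite mxE; apply/eqP.
by move: (x0 i (mem_index_enum i)); rewrite /= mulf_eq0 orbb.
Qed.

Lemma dot_gt0 x : x != 0 -> 0 < dot x x.
Proof.
by move=> x0; rewrite lt_neqAle dot_ge0 andbT eq_sym; apply: contraNneq x0 => /dot_eq0 ->.
Qed.

Lemma normr_coord x i : `|x ord0 i| <= `|x|.
Proof.
rewrite [leRHS]/Num.Def.normr /= mx_normrE.
by apply/bigmax_geP; right; exists (ord0, i).
Qed.

Lemma dot_le_norm x y : dot x y <= n%:R * `|x| * `|y|.
Proof.
rewrite -mulrA mulr_natl -[X in _ *+ X]card_ord -sumr_const; apply: ler_sum => i _.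
by rewrite (le_trans (ler_norm _))// normrM ler_pM// normr_coord.
Qed.

(** The norm is the maximum norm; it is attained at a coordinate, whose square is one of the
    summands of [dot x x]. *)
Lemma norm_le_dot x : `|x| ^+ 2 <= dot x x.
Proof.
have [->|x0] := eqVneq x 0; first by rewrite normr0 expr0n dot0l.
have [[i j] /= E] : exists ij : 'I_1 * 'I_n, `|x| = `|x ij.1 ij.2|.
  by apply: mx_norm_neq0; have := x0; rewrite -normr_eq0.
rewrite E -normrX ger0_norm ?sqr_ge0// (ord1 i) [leRHS](bigD1 j)//= expr2 lerDl.
by apply: sumr_ge0 => k _; rewrite -expr2 sqr_ge0.
Qed.

Lemma fun_continuousD (X : topologicalType) (V : normedModType R) (f g : X -> V) :
  continuous f -> continuous g -> continuous (fun t => f t + g t).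
Proof. by move=> cf cg t; exact: continuousD (cf t) (cg t). Qed.

Lemma fun_continuousB (X : topologicalType) (V : normedModType R) (f g : X -> V) :
  continuous f -> continuous g -> continuous (fun t => f t - g t).
Proof. by move=> cf cg t; exact: continuousB (cf t) (cg t). Qed.

Lemma fun_continuousZ (X : topologicalType) (V : normedModType R) (f : X -> V) a :
  continuous f -> continuous (fun t => a *: f t).
Proof. by move=> cf t; apply: continuousZl_tmp (cf t). Qed.

Lemma sum_continuous (X : topologicalType) (V : normedModType R) (I : Type)
    (r : seq I) (F : I -> X -> V) :
  (forall i, continuous (F i)) -> continuous (fun t => \sum_(i <- r) F i t).
Proof.
move=> cF; elim: r => [|i r IH].
  rewrite (_ : (fun _ => _) = cst 0); first exact: cst_continuous.
  by apply/funext => t; rewrite big_nil.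
rewrite (_ : (fun _ => _) = F i \+ (fun t => \sum_(j <- r) F j t)).
  by move=> t; apply: continuousD; [exact: cF | exact: IH].
by apply/funext => t; rewrite big_cons.
Qed.

Lemma dot_continuous (X : topologicalType) (f g : X -> 'rV[R]_n) :
  continuous f -> continuous g -> continuous (fun t => dot (f t) (g t)).
Proof.
move=> cf cg; apply: (@sum_continuous _ R^o) => i t.
apply: (@continuousM _ _ (fun s => f s ord0 i) (fun s => g s ord0 i)).
  exact: (continuous_comp (cf t) (@coord_continuous _ _ _ ord0 i _)).
exact: (continuous_comp (cg t) (@coord_continuous _ _ _ ord0 i _)).
Qed.

Lemma dot_continuousr x : continuous (dot x).
Proof.
by apply: (@dot_continuous _ (cst x) id); [exact: cst_continuous | move=> y; exact: cvg_id].
Qed.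

End Dot.

(** * Normal cones, polar sets, and the gauge as a support function *)

Section ConvexBody.
Variables (R : realType) (n : nat).
Implicit Types (C : set 'rV[R]_n) (u x y z p : 'rV[R]_n).

Lemma compact_bd_mem C z : compact C -> bd C z -> C z.
Proof. by move=> cC [+ _]; rewrite -(closure_id C).1//; exact: compact_closed. Qed.

Lemma interior_ball C : interior C 0 -> exists2 r : R, 0 < r & forall x, `|x| <= r -> C x.
Proof.
move=> /nbhs_ballP[r /= r0 rC]; exists (r / 2); first by rewrite divr_gt0.
move=> x xr; apply: rC; rewrite -ball_normE /= sub0r normrN (le_lt_trans xr)//.
by rewrite ltr_pdivrMr// ltr_pMr// ltr1n.
Qed.

Lemma interior_push C z u : interior C z -> exists2 e : R, 0 < e & C (z + e *: u).
Proof.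
move=> /nbhs_ballP[r /= r0 rC].
have u1 : 0 < `|u| + 1 by rewrite ltr_wpDl.
exists (r / (`|u| + 1)); first by rewrite divr_gt0.
apply: rC; rewrite -ball_normE /= opprD addNKr normrN normrZ gtr0_norm ?divr_gt0//.
by rewrite mulrAC ltr_pdivrMr// ltr_pM2l// ltrDl.
Qed.

(** The multiple of [x] of norm [r] lies in [C]; testing [x] against it gives the bound [c / r]. *)
Lemma polar_scale_compact C (c : R) : interior C 0 -> 0 < c ->
  compact [set x | forall y, C y -> dot y x <= c].
Proof.
move=> C0 c0; apply: bounded_closed_compact.
  have [r r0 rC] := interior_ball C0.
  exists (c / r); split; first by rewrite num_real.
  move=> M cM x /= xc; apply: le_trans (ltW cM).
  have [->|x0] := eqVneq x 0; first by rewrite normr0 ltW// divr_gt0.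
  have nx : 0 < `|x| by rewrite normr_gt0.
  have /rC /xc : `|(r / `|x|) *: x| <= r.
    by rewrite normrZ gtr0_norm ?divr_gt0// divfK// gt_eqF.
  rewrite dotZl => xxc; rewrite ler_pdivlMr// mulrC.
  apply: le_trans xxc; rewrite -mulrA ler_pM2l// mulrC ler_pdivlMr// -expr2.
  exact: norm_le_dot.
rewrite (_ : mkset _ = \bigcap_(y in C) [set x | dot y x <= c]).
  apply: closed_bigI => y _.
  apply: (@closed_comp _ _ (dot y) [set t | t <= c]); last exact: closed_le.
  by move=> x _; exact: dot_continuousr.
by apply/seteqP; split=> x /= xc y Cy; exact: xc.
Qed.

Lemma normal_cone0 C z : normal_cone C z 0.
Proof. by move=> y _; rewrite dot0l. Qed.

Lemma normal_coneD C z u v : normal_cone C z u -> normal_cone C z v ->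
  normal_cone C z (u + v).
Proof. by move=> Cu Cv y Cy; rewrite dotDl -(addr0 0) lerD ?Cu ?Cv. Qed.

Lemma normal_coneZ C z u (a : R) : 0 <= a -> normal_cone C z u ->
  normal_cone C z (a *: u).
Proof. by move=> a0 Cu y Cy; rewrite dotZl mulr_ge0_le0 ?Cu. Qed.

Lemma interior_normal_cone C z u : interior C z -> normal_cone C z u -> u = 0.
Proof.
move=> /(@interior_push _ _ u)[e e0 Ce] /(_ _ Ce); rewrite addrC addKr dotZr.
rewrite pmulr_rle0// => u0; apply: dot_eq0; apply/eqP.
by rewrite eq_le u0 dot_ge0.
Qed.

Lemma normal_cone_gt0 C p u : interior C 0 -> normal_cone C p u -> u != 0 -> 0 < dot u p.
Proof.
move=> /(@interior_push _ _ u)[e e0 Ce] /(_ _ Ce); rewrite add0r dotBr dotZr subr_le0.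
by move=> up u0; apply: lt_le_trans up; rewrite mulr_gt0// dot_gt0.
Qed.

(** Two maximizers would have an interior midpoint, which could be pushed along [u] beyond the
    maximum. *)
Lemma maximizer_unique C u p p' : strictly_convex C -> u != 0 -> C p -> C p' ->
  normal_cone C p u -> normal_cone C p' u -> p = p'.
Proof.
move=> sC u0 Cp Cp' up up'; apply/eqP/negPn/negP => pp'.
have [|e e0] := @interior_push C (2^-1 *: p + (1 - 2^-1) *: p') u.
  by apply: sC => //; apply/andP; split; lra.
have u1 := dot_gt0 u0.
move=> Ce; have := up _ Ce; have := up' _ Ce; have := up _ Cp'; have := up' _ Cp.
rewrite !dotBr !dotDr !dotZr; set a := dot u p; set b := dot u p'.
have : 0 < e * dot u u by rewrite mulr_gt0.
lra.
Qed.

Section Gauge.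
Variable T : set 'rV[R]_n.
Hypothesis bT : convex_body T.
Local Notation g := (gauge_polar T).

Let T0 : T 0. Proof. by case: bT => _ [_ /interior_subset]. Qed.

(** Identifies the gauge of the polar with the support function of [T], attained by compactness. *)
Lemma gauge_max x : exists p, [/\ T p, g x = dot x p & normal_cone T p x].
Proof.
have cT : compact T by case: bT.
have cx : {within T, continuous (dot x)}.
  by apply: continuous_subspaceT; exact: dot_continuousr.
have [p] := EVT_max_rV (ex_intro _ _ T0) cT cx.
rewrite inE => Tp pmax; have {}pmax y : T y -> dot x y <= dot x p.
  by move=> Ty; apply: pmax; rewrite inE.
exists p; split=> //; last by move=> y Ty; rewrite dotBr subr_le0 pmax.
have p0 : 0 <= dot x p by rewrite -(dot0r x) pmax.
have lb : lbound [set t : R | 0 <= t /\ exists y, polar T y /\ x = t *: y] (dot x p).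
  move=> t [t0 [y [Ty ->]]]; rewrite dotZl ler_piMr// dotC.
  exact: Ty.
have mem : [set t : R | 0 <= t /\ exists y, polar T y /\ x = t *: y] (dot x p).
  (* A zero maximum cannot be inverted; it forces [x = 0], since [T] contains a positive multiple of
     [x]. *)
  split=> //; have [px|px] := eqVneq (dot x p) 0; last first.
    exists ((dot x p)^-1 *: x); split; last by rewrite scalerA divff// scale1r.
    have pgt0 : 0 < dot x p by rewrite lt_neqAle eq_sym px.
    by move=> y Ty; rewrite dotZr (dotC y) mulrC ler_pdivrMr// mul1r pmax.
  exists 0; split; first by move=> y _; rewrite dot0r.
  rewrite scaler0; apply/eqP/negPn/negP => x0; case: bT => _ [_ /interior_push].
  move=> /(_ x)[e e0]; rewrite add0r => /pmax; rewrite px dotZr pmulr_rle0// leNgt.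
  by rewrite dot_gt0.
apply/eqP; rewrite eq_le; apply/andP; split.
  by apply: ge_inf => //; exists (dot x p).
by apply: lb_le_inf => //; exists (dot x p).
Qed.

Lemma dot_le_gauge x y : T y -> dot x y <= g x.
Proof. by move=> Ty; have [p [Tp -> /(_ _ Ty)]] := gauge_max x; rewrite dotBr subr_le0. Qed.

Lemma gauge_normal x p : T p -> normal_cone T p x -> g x = dot x p.
Proof.
move=> Tp px; apply/eqP; rewrite eq_le dot_le_gauge// andbT.
by have [p' [Tp' -> _]] := gauge_max x; have := px _ Tp'; rewrite dotBr subr_le0.
Qed.

Lemma gauge_ge0 x : 0 <= g x.
Proof. by rewrite -(dot0r x) dot_le_gauge. Qed.

Lemma gaugeD x y : g (x + y) <= g x + g y.
Proof. by have [p [Tp -> _]] := gauge_max (x + y); rewrite dotDl lerD ?dot_le_gauge. Qed.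

Lemma gaugeZ (a : R) x : 0 <= a -> g (a *: x) = a * g x.
Proof.
move=> a0; have [p [Tp -> px]] := gauge_max x.
by rewrite (gauge_normal Tp) ?dotZl//; exact: normal_coneZ.
Qed.

Lemma gauge_gt0 x : x != 0 -> 0 < g x.
Proof.
move=> x0; have [p [_ -> px]] := gauge_max x.
by apply: normal_cone_gt0 px x0; case: bT => _ [].
Qed.

Lemma gauge_continuous : continuous g.
Proof.
have [B [_ TB]] : bounded_set T by apply: compact_bounded; case: bT.
pose c := n%:R * (`|B| + 1).
have c0 : 0 <= c by rewrite mulr_ge0// addr_ge0.
have gc x : g x <= c * `|x|.
  have [p [Tp -> _]] := gauge_max x; rewrite (le_trans (dot_le_norm _ _))//.
  rewrite mulrAC ler_wpM2r// ler_wpM2l// TB//.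
  by rewrite (le_lt_trans (ler_norm B))// ltrDl.
have gL x y : `|g x - g y| <= c * `|x - y|.
  rewrite ler_norml lerNl opprB !lerBlDr; apply/andP; split.
    rewrite distrC (le_trans _ (lerD (gc _) (lexx _)))//.
    by rewrite -[leLHS](_ : g (y - x + x) = _) ?gaugeD ?subrK.
  rewrite (le_trans _ (lerD (gc _) (lexx _)))//.
  by rewrite -[leLHS](_ : g (x - y + y) = _) ?gaugeD ?subrK.
move=> x; apply/(@cvgrPdist_lt _ _ _ (nbhs x) _ g (g x)) => e e0.
have c1 : 0 < c + 1 by rewrite ltr_wpDl.
apply/nbhs_ballP; exists (e / (c + 1)) => [|y]; first exact: divr_gt0.
rewrite -ball_normE /= ltr_pdivlMr// mulrC => xy; apply: le_lt_trans (gL _ _) _.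
by apply: le_lt_trans xy; rewrite ler_wpM2r// lerDl.
Qed.

(* On the compact part of [T] where [dot d] exceeds [dot d p + eta], the functional
   [dot u] stays below its maximum by a fixed amount, which absorbs [e * dot d]. *)
Lemma gauge_directional u d p (eta : R) : strictly_convex T -> u != 0 -> T p ->
  normal_cone T p u -> 0 < eta ->
  \forall e \near (0 : R)^'+, g (u + e *: d) <= g u + e * (dot d p + eta).
Proof.
move=> sT u0 Tp pu eta0; rewrite (gauge_normal Tp pu).
pose A := T `&` [set y | dot d p + eta <= dot d y].
have cA : compact A.
  apply: compact_closedI; first by case: bT.
  apply: (@closed_comp _ _ (dot d) [set t | dot d p + eta <= t]).
    by move=> x _; exact: dot_continuousr.
  exact: closed_ge.
have [/set0P An|/negPn/eqP A0] := boolP (A != set0); last first.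
  near=> e; have e0 : 0 < e by [].
  have [y [Ty -> _]] := gauge_max (u + e *: d).
  have := pu _ Ty; rewrite dotBr subr_le0 dotDl dotZl => uy.
  rewrite lerD// ler_pM2l// leNgt; apply/negP => /ltW dy.
  by have : A y by []; rewrite A0.
have [y1] := EVT_max_rV An cA (continuous_subspaceT (@dot_continuousr _ _ u)).
rewrite inE => -[Ty1 dy1] y1max.
have lt1 : dot u y1 < dot u p.
  rewrite ltNge; apply/negP => le1.
  have E : p = y1.
    apply: (maximizer_unique sT u0 Tp Ty1 pu) => y Ty.
    by rewrite dotBr subr_le0 (le_trans _ le1)//; have := pu _ Ty; rewrite dotBr subr_le0.
  by move: dy1; rewrite -E /= leNgt ltrDl eta0.
(* Exceeds the amount by which [dot d] on [T] can surpass [dot d p + eta]; the 1 makes it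
   positive. *)
pose c := `|g d - dot d p - eta| + 1.
have c0 : 0 < c by rewrite ltr_wpDl.
near=> e; have e0 : 0 < e by [].
have [y [Ty -> _]] := gauge_max (u + e *: d); rewrite dotDl dotZl.
have [dy|dy] := leP (dot d p + eta) (dot d y); last first.
  apply: lerD; last by rewrite ler_pM2l// ltW.
  by have := pu _ Ty; rewrite dotBr subr_le0.
have le1 : dot u y <= dot u y1 by apply: y1max; rewrite inE.
have le2 : e * c <= dot u p - dot u y1.
  rewrite -ler_pdivlMr//; near: e; apply: nbhs_right_le.
  by rewrite divr_gt0// subr_gt0.
have le3 : e * dot d y <= e * g d by rewrite ler_pM2l// dot_le_gauge.
have le4 : e * (g d - dot d p - eta) <= e * c.
  by rewrite ler_pM2l// (le_trans (ler_norm _))// lerDl.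
move: le1 le2 le3 le4; rewrite !(mulrBr, mulrDr); lra.
Unshelve. all: by end_near. Qed.

End Gauge.
End ConvexBody.

(** * Families of vectors, cyclic sums and the first-order condition *)

Section Families.
Variables (R : realType) (n m : nat).
Implicit Types (v w q a : 'I_m -> 'rV[R]_n) (x : 'rV[R]_n).

Definition fdot v w : R := \sum_(j < m) dot (v j) (w j).

Lemma fdotC v w : fdot v w = fdot w v.
Proof. by apply: eq_bigr => j _; rewrite dotC. Qed.

Lemma fdot_comb v w w' (e : R) :
  fdot v (fun j => w j + e *: w' j) = fdot v w + e * fdot v w'.
Proof.
by rewrite mulr_sumr -big_split; apply: eq_bigr => j _; rewrite dotDr dotZr.
Qed.

Lemma fdotZr v w (e : R) : fdot v (fun j => e *: w j) = e * fdot v w.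
Proof. by rewrite mulr_sumr; apply: eq_bigr => j _; rewrite dotZr. Qed.

Lemma fdotZl v w (e : R) : fdot (fun j => e *: v j) w = e * fdot v w.
Proof. by rewrite mulr_sumr; apply: eq_bigr => j _; rewrite dotZl. Qed.

Lemma fdot_translate v w x : \sum_j v j = 0 -> fdot v (fun j => w j + x) = fdot v w.
Proof.
move=> v0; rewrite -[RHS]addr0 -(dot0l x) -v0 dot_suml -big_split.
by apply: eq_bigr => j _; rewrite dotDr.
Qed.

(** The cross term pairs [x] with the zero sum, so centring a family is the optimal translation. *)
Lemma fdot_le_translate v x : \sum_j v j = 0 ->
  fdot v v <= fdot (fun j => v j + x) (fun j => v j + x).
Proof.
move=> v0; have -> : fdot (fun j => v j + x) (fun j => v j + x) =
    fdot v (fun j => v j + x) + \sum_j dot x (v j + x).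
  by rewrite -big_split; apply: eq_bigr => j _; rewrite dotDl.
rewrite fdot_translate// lerDl; under eq_bigr do rewrite dotDr dotC.
by rewrite big_split /= -dot_suml v0 dot0l add0r sumr_ge0// => j _; exact: dot_ge0.
Qed.

Lemma fdot_ge0 v : 0 <= fdot v v.
Proof. by apply: sumr_ge0 => j _; exact: dot_ge0. Qed.

Lemma fdot_eq0 v : fdot v v = 0 -> forall j, v j = 0.
Proof.
move=> /eqP; rewrite psumr_eq0 => [/allP v0 j|j _]; last exact: dot_ge0.
by apply: dot_eq0; apply/eqP; exact: (v0 j (mem_index_enum j)).
Qed.

Lemma fdot_gt0 v j : v j != 0 -> 0 < fdot v v.
Proof.
move=> vj; rewrite lt_neqAle fdot_ge0 andbT eq_sym.
by apply: contraNneq vj => /fdot_eq0 ->.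
Qed.

(** Farkas' lemma for one inequality: the component [b] of [a] orthogonal to [v] is allowed with
    either sign, and testing [- b] forces it to vanish. *)
Lemma halfspace_proportional v a j : v j != 0 ->
  (forall w, 0 <= fdot v w -> 0 <= fdot a w) ->
  exists2 s, 0 <= s & forall j, a j = s *: v j.
Proof.
move=> /fdot_gt0 vv va; pose s := fdot v a / fdot v v.
pose b := fun i => a i - s *: v i.
have vb : fdot v b = 0.
  rewrite /b; under eq_fun do rewrite -scaleNr.
  by rewrite fdot_comb mulNr divfK ?gt_eqF// subrr.
exists s; first by rewrite divr_ge0 ?(ltW vv)// fdotC va// ltW.
have bb : fdot a (fun i => - 1 *: b i) = - fdot b b.
  have -> : fdot b b = fdot b (fun i => a i + - s *: v i).
    by apply: eq_bigr => i _; rewrite /b scaleNr.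
  by rewrite fdot_comb (fdotC b v) vb mulr0 addr0 fdotZr mulN1r fdotC.
move=> i; apply/eqP; rewrite -subr_eq0; apply/eqP; move: i; apply: fdot_eq0.
apply/eqP; rewrite eq_le fdot_ge0 andbT -oppr_ge0 -bb va//.
by rewrite fdotZr vb mulr0.
Qed.

Lemma sum_cyc_diff (V : zmodType) (f : 'I_m -> V) :
  \sum_j (f (cyc_pred j) - f j) = 0.
Proof.
rewrite sumrB [X in _ - X](reindex_inj (can_inj (@ord_predK m))) /=.
by apply/eqP; rewrite subr_eq0.
Qed.

(** Summation by parts: it turns the derivative of the length, a sum over edges, into a functional
    of the vertex displacements. *)
Lemma fdot_cyc_diff a w : fdot (fun j => a (cyc_pred j) - a j) w =
  \sum_j dot (w (cyc_succ j) - w j) (a j).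
Proof.
rewrite /fdot; under eq_bigr do rewrite dotBl.
rewrite sumrB [X in X - _](reindex_inj (@ordS_inj m)) -sumrB.
by apply: eq_bigr => j _; rewrite /cyc_pred ordSK dotBl !(dotC (a j)).
Qed.

(** An allowed direction with negative derivative would shorten the curve, as [gauge_directional]
    bounds every edge up to a slack [eta]. So the derivative is nonnegative on a half-space. *)
Lemma first_order_condition (T : set 'rV[R]_n) q p v j0 :
  convex_body T -> strictly_convex T ->
  (forall j, q j != q (cyc_succ j)) -> (forall j, T (p j)) ->
  (forall j, normal_cone T (p j) (q (cyc_succ j) - q j)) -> v j0 != 0 ->
  (forall w, 0 <= fdot v w -> forall e, 0 < e ->
     ellT T q <= ellT T (fun j => q j + e *: w j)) ->
  exists2 s, 0 <= s & forall j, p (cyc_pred j) - p j = s *: v j.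
Proof.
move=> bT sT qq Tp qp vj0 qmin.
apply: (halfspace_proportional (a := fun j => p (cyc_pred j) - p j) vj0) => w vw.
rewrite fdot_cyc_diff; set d := fun j => w (cyc_succ j) - w j.
rewrite leNgt; apply/negP; set S := \sum_j _ => S0.
(* Dividing by [m.+1] keeps the total slack of the [m] edges strictly below [- S]. *)
pose eta := - S / m.+1%:R.
have eta0 : 0 < eta by rewrite divr_gt0// oppr_gt0.
suff : \forall e \near (0 : R)^'+, False by move=> /filter_ex[].
near=> e.
have e0 : 0 < e by [].
have H j : gauge_polar T (q (cyc_succ j) - q j + e *: d j) <=
    gauge_polar T (q (cyc_succ j) - q j) + e * (dot (d j) (p j) + eta).
  move: j; near: e; apply: filter_forall => j.
  by apply: gauge_directional => //; rewrite subr_eq0 eq_sym.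
have := qmin _ vw _ e0; apply/negP; rewrite -ltNge.
have -> : ellT T (fun j => q j + e *: w j) =
    \sum_j gauge_polar T (q (cyc_succ j) - q j + e *: d j).
  apply: eq_bigr => j _; congr gauge_polar.
  by rewrite /d scalerBr opprD addrACA.
apply: le_lt_trans (ler_sum _ (fun j _ => H j)) _.
rewrite big_split /= gtrDl -mulr_sumr pmulr_rlt0// big_split /= -/S sumr_const card_ord.
rewrite -mulr_natr /eta mulNr mulNr subr_lt0 mulrAC -mulrA.
have m0 : 0 < m.+1%:R :> R by [].
rewrite -subr_gt0 -[X in _ - X]mulr1 -mulrBr.
rewrite nmulr_rgt0// subr_lt0 ltr_pdivrMr// mul1r ltr_nat.
Unshelve. all: by end_near. Qed.

(** The two supporting hyperplanes coincide, so the part [z] of [u2] orthogonal to [u1] is also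
    orthogonal to [u2] and vanishes. Both normals are positive at [p], which fixes the sign. *)
Lemma smooth_normal_parallel (T : set 'rV[R]_n) p u1 u2 :
  convex_body T -> smooth_body T -> bd T p -> normal_cone T p u1 ->
  normal_cone T p u2 -> u1 != 0 -> u2 != 0 -> exists2 c, 0 < c & u2 = c *: u1.
Proof.
move=> bT smT bp Nu1 Nu2 u10 u20.
have /smT[_ /(_ [set x | dot u1 x = dot u1 p] [set x | dot u2 x = dot u2 p])] := bp.
move=> /(_ (ex_intro _ u1 _) (ex_intro _ u2 _)) H12.
have {}H12 := H12 (conj u10 (conj Nu1 erefl)) (conj u20 (conj Nu2 erefl)).
have T0 : interior T 0 by case: bT => _ [].
have u11 := dot_gt0 u10.
pose c := dot u1 u2 / dot u1 u1; pose z := u2 - c *: u1.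
have u1z : dot u1 z = 0 by rewrite dotBr dotZr divfK ?subrr// gt_eqF.
have : [set x | dot u1 x = dot u1 p] (p + z) by rewrite /= dotDr u1z addr0.
rewrite H12 /= dotDr -[RHS]addr0 => /addrI u2z.
have z0 : z = 0 by apply: dot_eq0; rewrite {1}/z dotBl dotZl u1z u2z mulr0 subr0.
have E : u2 = c *: u1 by apply/eqP; rewrite -subr_eq0 -/z z0.
exists c => //; have := normal_cone_gt0 T0 Nu2 u20.
by rewrite E dotZl pmulr_lgt0// (normal_cone_gt0 T0 Nu1).
Qed.

(** Otherwise both edges at [q j] are normals of [T] at one point, hence positively parallel, and
    [q j] lies between its neighbours. *)
Lemma billiard_normals_distinct (T : set 'rV[R]_n) q p j :
  convex_body T -> smooth_body T -> closed_polygon q -> (forall j, bd T (p j)) ->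
  (forall j, normal_cone T (p j) (q (cyc_succ j) - q j)) ->
  p (cyc_pred j) - p j != 0.
Proof.
move=> bT smT [_ qq] bp qp; rewrite subr_eq0; apply/negP => /eqP pp.
have jK : cyc_succ (cyc_pred j) = j by exact: ord_predK.
have u1 : normal_cone T (p j) (q j - q (cyc_pred j)).
  by have := qp (cyc_pred j); rewrite jK pp.
have u10 : q j - q (cyc_pred j) != 0.
  by have [+ _] := qq (cyc_pred j); rewrite jK subr_eq0 eq_sym.
have u20 : q (cyc_succ j) - q j != 0.
  by rewrite subr_eq0 eq_sym; case: (qq j).
have [c c0 E] := smooth_normal_parallel bT smT (bp j) u1 (qp j) u10 u20.
have [_] := qq j; apply.
have c1 : 1 + c != 0 by rewrite gt_eqF// ltr_wpDl.
exists (c / (1 + c)); split.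
  rewrite divr_ge0 ?ler_pdivrMr ?mul1r ?lerDr ?ltW ?ltr_wpDl//=.
have -> : q (cyc_succ j) = q j + c *: (q j - q (cyc_pred j)).
  by rewrite -E addrC subrK.
have -> : 1 - c / (1 + c) = (1 + c)^-1.
  by rewrite -{1}(divff c1) -mulrBl addrK mul1r.
rewrite mulrC -scalerA -scalerDr; apply: (scalerI c1); rewrite scalerA divff// scale1r.
by apply/rowP => i; rewrite !mxE; ring.
Qed.

End Families.

(** * Certificates and separation from [K ^ m] *)

Lemma prod_compact (R : realType) (n m : nat) (A : 'I_m -> set 'rV[R]_n) :
  (forall i, compact (A i)) ->
  @compact (prod_topology (fun _ : 'I_m => 'rV[R]_n)) [set f | forall i, A i (f i)].
Proof. by move=> cA; apply: tychonoff. Qed.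

Section Blocking.
Variables (R : realType) (n : nat) (K : set 'rV[R]_n).
Hypothesis bK : convex_body K.

Let K0 : K 0. Proof. by case: bK => _ [_ /interior_subset]. Qed.

Section Fixed.
Variable m : nat.
Implicit Types (v w q k : 'I_m -> 'rV[R]_n) (x : 'rV[R]_n).

(** These are the zero-sum elements of the polar of [K ^ m]; the zero sum makes the pairing with a
    curve invariant under translation. *)
Definition normal_certificate v : Prop :=
  \sum_j v j = 0 /\ forall k, (forall j, K (k j)) -> fdot v k <= 1.

(* If [v] blocks [q], then no translate of [q] lies in the interior of [K]. *)
Definition blocks v q : Prop := normal_certificate v /\ 1 <= fdot v q.

Lemma fdot_single v j x : fdot v (fun i => if i == j then x else 0) = dot (v j) x.
Proof.
rewrite /fdot (bigD1 j)//= eqxx big1 ?addr0// => i /negPf ->.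
exact: dot0r.
Qed.

Lemma support_gt0 v j (b : R) : v j != 0 ->
  (forall k, (forall i, K (k i)) -> fdot v k <= b) -> 0 < b.
Proof.
move=> vj vb; have [_ [_ /(@interior_push _ _ _ _ (v j))[e e0 Ke]]] := bK.
apply: lt_le_trans (vb (fun i => if i == j then 0 + e *: v j else 0) _).
  by rewrite fdot_single add0r dotZr mulr_gt0// dot_gt0.
by move=> i; case: ifP.
Qed.

Lemma normal_certificate_scale v j (b : R) : \sum_j v j = 0 -> v j != 0 ->
  (forall k, (forall i, K (k i)) -> fdot v k <= b) ->
  normal_certificate (fun i => b^-1 *: v i).
Proof.
move=> v0 vj vb; split; first by rewrite -scaler_sumr v0 scaler0.
move=> k Kk; rewrite fdotZl mulrC ler_pdivrMr ?mul1r ?vb//.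
exact: support_gt0 vj vb.
Qed.

Lemma normal_certificate_polar v j : normal_certificate v -> polar K (v j).
Proof.
move=> [_ vK] x Kx; rewrite dotC -fdot_single; apply: vK => i.
by case: ifP.
Qed.

Lemma blocks_translate v q x : blocks v q -> blocks v (fun j => q j + x).
Proof. by case=> -[v0 vK] vq; split=> //; rewrite fdot_translate. Qed.

End Fixed.

(** Minimizes the distance from [K ^ m] to the translates of [q]. If it is positive, the residual at
    a nearest point separates, and normalizing it gives the certificate. *)
Lemma translate_or_block (m : nat) (q : 'I_m -> 'rV[R]_n) :
  (exists x, forall j, K (q j + x)) \/
  exists2 v, normal_certificate v & 1 < fdot v q.
Proof.
case: m q => [|m] q; first by left; exists 0 => -[].
pose X := prod_topology (fun _ : 'I_m.+1 => 'rV[R]_n).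
(* The mean difference is the best translation for [k]: the residual [V k] then has zero sum. *)
pose x (k : X) : 'rV[R]_n := m.+1%:R^-1 *: \sum_i (k i - q i).
pose V (k : X) j : 'rV[R]_n := (q j + x k) - k j.
have V0 k : \sum_j V k j = 0.
  rewrite /V sumrB big_split /= sumr_const card_ord -scaler_nat /x scalerA.
  by rewrite divff ?pnatr_eq0// scale1r sumrB addrCA subrr addr0 subrr.
have cj j : continuous (fun k : X => k j : 'rV[R]_n) by exact: (@proj_continuous _ (fun=> _)).
have cV j : continuous (V ^~ j).
  apply: (@fun_continuousB R X 'rV[R]_n); last exact: cj.
  apply: (@fun_continuousD R X 'rV[R]_n); first exact: cst_continuous.
  apply: (@fun_continuousZ R X 'rV[R]_n); apply: (@sum_continuous R X 'rV[R]_n) => i.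
  by apply: (@fun_continuousB R X 'rV[R]_n); [exact: cj | exact: cst_continuous].
have cf : continuous (fun k => fdot (V k) (V k)).
  apply: (@sum_continuous R X R^o _ _ (fun j k => dot (V k j) (V k j))) => j.
  exact: (@dot_continuous R n X (V ^~ j) (V ^~ j)).
pose A : set X := [set k | forall j, K (k j)].
have cA : compact A by apply: (@prod_compact R n m.+1 (fun=> K)); case: bK.
have A0 : A !=set0 by exists (fun=> 0).
have [k] := compact_EVT_min A0 cA (continuous_subspaceT cf).
rewrite inE => Ak kmin; set v := V k.
have [/eqP v0|vn0] := boolP (fdot v v == 0).
  left; exists (x k) => j; have /eqP := fdot_eq0 v0 j.
  by rewrite subr_eq0 => /eqP ->.
right.
have vmax k' : A k' -> fdot v k' <= fdot v k.
  move=> Ak'; pose e j := k' j - k j.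
  suff : fdot v e <= 0.
    rewrite (_ : fdot v k' = fdot v (fun j => k j + 1 *: e j)).
      by rewrite fdot_comb mul1r gerDl.
    by apply: eq_bigr => j _; rewrite scale1r addrC subrK.
  (* Compares [k] with the points of the segment from [k] to [k'], which stay in [K ^ m] by
     convexity. *)
  have small t : 0 < t -> t <= 1 -> 2 * fdot v e <= t * fdot e e.
    move=> t0 t1; pose kt : X := fun j => k j + t *: e j.
    have Akt : A kt.
      move=> j; case: bK => _ [cK _].
      have -> : kt j = t *: k' j + (1 - t) *: k j.
        by apply/rowP => i; rewrite !mxE; ring.
      by apply: cK; rewrite ?t1 ?ltW.
    have le1 : fdot v v <= fdot (V kt) (V kt) by apply: kmin; rewrite inE.
    (* Up to a translation the residual at [kt] is [v - t *: e]. *)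
    have := le_trans le1 (fdot_le_translate (x k - x kt) (V0 kt)).
    rewrite (_ : (fun j => _) = (fun j => v j + - t *: e j)); last first.
      by apply/funext => j; apply/rowP => i; rewrite /v /V /kt !mxE; ring.
    rewrite fdot_comb fdotC (fdotC _ e) !fdot_comb (fdotC e v) => le2.
    by rewrite -(ler_pM2l t0); lra.
  rewrite leNgt; apply/negP => c0; have e0 := fdot_ge0 e.
  have e1 : 0 < fdot e e + fdot v e by rewrite ltr_wpDl.
  (* This [t] is at most 1 and small enough for the linear term to beat the quadratic one. *)
  have := small (fdot v e / (fdot e e + fdot v e)).
  rewrite divr_gt0// ler_pdivrMr// mul1r lerDr e0 => /(_ isT isT).
  rewrite mulrAC ler_pdivlMr// => le3.
  have : 0 < fdot v e * fdot v e by rewrite mulr_gt0.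
  have : 0 <= fdot v e * fdot e e by rewrite mulr_ge0// ltW.
  by move: le3; lra.
have [j vj] : exists j, v j != 0.
  apply/existsP; apply: contraNT vn0 => /existsPn v0.
  by rewrite /fdot big1// => j _; have /negPn/eqP -> := v0 j; exact: dot0l.
exists (fun j => (fdot v k)^-1 *: v j).
  by apply: normal_certificate_scale (V0 k) vj _ => k'; exact: vmax.
have b0 : 0 < fdot v k by exact: (support_gt0 vj vmax).
rewrite fdotZl mulrC ltr_pdivlMr// mul1r -(fdot_translate q (x k) (V0 k)).
rewrite (_ : fdot v (fun j => q j + _) = fdot v (fun j => k j + 1 *: v j)).
  by rewrite fdot_comb mul1r ltrDl (fdot_gt0 vj).
by apply: eq_bigr => i _; congr dot; rewrite scale1r /v /V addrCA subrr addr0.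
Qed.

End Blocking.

(** * Existence of a shortest blocked curve *)

Section Minimizer.
Variables (R : realType) (n : nat) (K T : set 'rV[R]_n).
Hypotheses (bK : convex_body K) (bT : convex_body T).
Local Notation g := (gauge_polar T).

Lemma ellT_translate m (q : 'I_m -> 'rV[R]_n) x :
  ellT T (fun j => q j + x) = ellT T q.
Proof. by apply: eq_bigr => j _; rewrite opprD addrACA subrr addr0. Qed.

Lemma ellT_scale m (q : 'I_m -> 'rV[R]_n) (a : R) : 0 <= a ->
  ellT T (fun j => a *: q j) = a * ellT T q.
Proof.
move=> a0; rewrite mulr_sumr; apply: eq_bigr => j _.
by rewrite -scalerBr gaugeZ.
Qed.

Lemma gauge_le_ellT m (q : 'I_m -> 'rV[R]_n) j : g (q (cyc_succ j) - q j) <= ellT T q.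
Proof. by rewrite /ellT (bigD1 j)//= lerDl sumr_ge0// => i _; exact: gauge_ge0. Qed.

Lemma gauge_diameter m (q : 'I_m.+1 -> 'rV[R]_n) (j : 'I_m.+1) :
  g (q j - q ord0) <= m.+1%:R * ellT T q.
Proof.
have ell0 : 0 <= ellT T q by apply: sumr_ge0 => i _; exact: gauge_ge0.
suff H k (lk : (k < m.+1)%N) : g (q (Ordinal lk) - q ord0) <= k%:R * ellT T q.
  case: j => k lk; apply: le_trans (H k lk) _.
  by rewrite ler_wpM2r// ler_nat ltnW.
elim: k lk => [|k IH] lk.
  rewrite (_ : Ordinal lk = ord0) ?subrr; last exact: val_inj.
  by rewrite -(scale0r 0) gaugeZ// !mul0r.
have lk' := ltnW lk.
have -> : Ordinal lk = cyc_succ (Ordinal lk') by apply: val_inj; rewrite /= modn_small.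
rewrite -(subrK (q (Ordinal lk')) (q (cyc_succ _))) -addrA.
apply: le_trans (gaugeD bT _ _) _.
by rewrite -natr1 mulrDl mul1r [leRHS]addrC; apply: lerD (gauge_le_ellT _ _) (IH _).
Qed.

(** Curve and certificate vary together. Moving the first vertex to [0] confines the curves no
    longer than [q0] to a compact product, certificates lie in the polar of [K], and blocking is a
    closed condition. *)
Lemma ellT_minimizer m (q0 v0 : 'I_m -> 'rV[R]_n) : blocks K v0 q0 ->
  exists q v : 'I_m -> 'rV[R]_n, blocks K v q /\
    forall q' v' : 'I_m -> 'rV[R]_n, blocks K v' q' -> ellT T q <= ellT T q'.
Proof.
case: m q0 v0 => [|m] q0 v0 b0.
  by case: b0 => _; rewrite /fdot big_ord0 ler10.
pose Y := prod_topology (fun _ : 'I_m.+1 => 'rV[R]_n); pose X := (Y * Y)%type.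
have cY j : continuous (fun k : Y => k j : 'rV[R]_n) by exact: (@proj_continuous _ (fun=> _)).
have cq j : continuous (fun s : X => s.1 j : 'rV[R]_n).
  by move=> s; apply: (continuous_comp (@cvg_fst _ _ _ _ _) (cY j _)).
have cv j : continuous (fun s : X => s.2 j : 'rV[R]_n).
  by move=> s; apply: (continuous_comp (@cvg_snd _ _ _ _ _) (cY j _)).
(* Bounds the gauge of any vertex minus the first one in a curve no longer than [q0]; the first
   factor of [A] states this bound through a scaled polar of [T]. *)
pose c := m.+1%:R * ellT T q0 + 1.
have ell0 (q : 'I_m.+1 -> 'rV[R]_n) : 0 <= ellT T q by apply: sumr_ge0 => i _; exact: gauge_ge0.
have c0 : 0 < c by rewrite ltr_wpDl// mulr_ge0.
pose A := ([set q : Y | forall j, [set x | forall y, T y -> dot y x <= c] (q j)] `*`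
           [set v : Y | forall j, [set x | forall y, K y -> dot y x <= 1] (v j)]) : set X.
have cA : compact A.
  apply: compact_setX; apply: (@prod_compact R n m.+1 (fun=> _)) => _;
    by apply: polar_scale_compact => //; case: bT => _ []; case: bK => _ [].
pose B := [set s : X | blocks K s.2 s.1].
have clB : closed B.
  rewrite (_ : B = [set s : X | dot (\sum_j s.2 j) (\sum_j s.2 j) = 0] `&`
    (\bigcap_(k in [set k : 'I_m.+1 -> 'rV[R]_n | forall j, K (k j)])
       [set s : X | fdot s.2 k <= 1]) `&` [set s : X | 1 <= fdot s.2 s.1]).
    apply: closedI; first apply: closedI.
    - have cs : continuous (fun s : X => \sum_j s.2 j).
        by apply: (@sum_continuous R X 'rV[R]_n); exact: cv.
      apply: (@closed_comp _ _ (fun s : X => dot (\sum_j s.2 j) (\sum_j s.2 j)) [set 0]).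
        by move=> s _; exact: (@dot_continuous R n X _ _ cs cs).
      exact: closed_eq.
    - apply: closed_bigI => k _.
      apply: (@closed_comp _ _ (fun s : X => fdot s.2 k) [set t | t <= 1]);
        last exact: closed_le.
      move=> s _; apply: (@sum_continuous R X R^o _ _ (fun j s => dot (s.2 j) (k j))) => j.
      by apply: (@dot_continuous R n X _ (cst (k j)) (cv j)); exact: cst_continuous.
    - apply: (@closed_comp _ _ (fun s : X => fdot s.2 s.1) [set t | 1 <= t]);
        last exact: closed_ge.
      move=> s _; apply: (@sum_continuous R X R^o _ _ (fun j s => dot (s.2 j) (s.1 j))) => j.
      exact: (@dot_continuous R n X _ _ (cv j) (cq j)).
  apply/seteqP; split=> [[q v] [[/= v0' vK] vq]|[q v] [[/= /dot_eq0 v0' vK] vq]].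
    by split=> //=; split=> //; rewrite v0' dot0l.
  by [].
have norm (q v : 'I_m.+1 -> 'rV[R]_n) : blocks K v q -> ellT T q <= ellT T q0 ->
    (A `&` B) ((fun j => q j - q ord0) : Y, v : Y).
  move=> vq le0; split; last exact: blocks_translate.
  split=> j /= y Ky; last exact: (normal_certificate_polar bK j vq.1).
  rewrite dotC (le_trans (dot_le_gauge bT _ Ky))//.
  rewrite (le_trans (gauge_diameter _ _))// /c (@le_trans _ _ (m.+1%:R * ellT T q0))//.
    by rewrite ler_wpM2l.
  by rewrite lerDl.
have AB0 : (A `&` B) !=set0 by eexists; apply: norm b0 _.
have cf : continuous (fun s : X => ellT T (s.1 : 'I_m.+1 -> 'rV[R]_n)).
  apply: (@sum_continuous R X R^o _ _ (fun j s => g (s.1 (cyc_succ j) - s.1 j))) => j s.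
  apply: (@continuous_comp _ _ _ (fun s : X => s.1 (cyc_succ j) - s.1 j) g).
    exact: (@fun_continuousB R X 'rV[R]_n _ _ (cq _) (cq _)).
  exact: gauge_continuous.
have [[q v] + smin] := compact_EVT_min AB0 (compact_closedI cA clB) (continuous_subspaceT cf).
rewrite inE => -[_ /= qv]; exists q, v; split=> // q' v' q'v'.
have [le0|/ltW le0] := leP (ellT T q') (ellT T q0).
  rewrite -[leRHS](ellT_translate _ (- q' ord0)).
  by apply: (smin (_, _)); rewrite inE; exact: (norm _ _ q'v' le0).
apply: le_trans le0; rewrite -[leRHS](ellT_translate _ (- q0 ord0)).
by apply: (smin (_, _)); rewrite inE; exact: (norm _ _ b0 (lexx _)).
Qed.

End Minimizer.

(** * Rotation and deletion of vertices *)

Lemma cyc_succ_add m (i c : 'I_m.+2) : cyc_succ (i + c) = cyc_succ i + c.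
Proof. by rewrite /cyc_succ -!(@add_1_Zp m.+2) addrA. Qed.

Section Reduction.
Variables (R : realType) (n : nat) (K T : set 'rV[R]_n).
Hypotheses (bK : convex_body K) (bT : convex_body T).
Local Notation g := (gauge_polar T).

Lemma blocks_rotate m (q v : 'I_m.+2 -> 'rV[R]_n) (c : 'I_m.+2) : blocks K v q ->
  blocks K (fun i => v (i + c)) (fun i => q (i + c)).
Proof.
have fdotc k : fdot (fun i => v (i + c)) (fun i => k (i + c)) = fdot v k :> R.
  by rewrite /fdot [RHS](reindex_inj (addIr c)).
move=> [[v0 vK] vq]; split; last by rewrite fdotc.
split=> [|k Kk]; first by rewrite -[RHS]v0 [RHS](reindex_inj (addIr c)).
rewrite (_ : k = fun i => k (i + c - c)); last by apply/funext => i; rewrite addrK.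
by rewrite (fdotc (fun i => k (i - c))); exact: vK.
Qed.

Lemma ellT_rotate m (q : 'I_m.+2 -> 'rV[R]_n) (c : 'I_m.+2) :
  ellT T (fun i => q (i + c)) = ellT T q.
Proof.
rewrite /ellT [RHS](reindex_inj (addIr c)); apply: eq_bigr => i _.
by rewrite cyc_succ_add.
Qed.

Let widen m : 'I_m.+1 -> 'I_m.+2 := widen_ord (leqnSn m.+1).

(** The vector [v ord_max] is shared between the two neighbours with weights [t] and [1 - t]. This
    preserves the pairing; convexity of [K] keeps the bound, and the triangle inequality controls
    the length. *)
Lemma delete_last_vertex m (q v : 'I_m.+2 -> 'rV[R]_n) (t : R) :
  blocks K v q -> 0 <= t <= 1 ->
  q ord_max = t *: q (widen ord_max) + (1 - t) *: q ord0 ->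
  exists q' v' : 'I_m.+1 -> 'rV[R]_n, blocks K v' q' /\ ellT T q' <= ellT T q.
Proof.
move=> [[v0 vK] vq] t01 qmax.
pose ext (k : 'I_m.+1 -> 'rV[R]_n) (i : 'I_m.+2) :=
  oapp k (t *: k ord_max + (1 - t) *: k ord0) (insub (i : nat)).
have extW k i : ext k (widen i) = k i.
  by rewrite /ext (_ : insub _ = Some i)//; exact: valK.
have extM k : ext k ord_max = t *: k ord_max + (1 - t) *: k ord0.
  by rewrite /ext insubF//= ltnn.
have widen0 : widen ord0 = ord0 :> 'I_m.+2 by exact: val_inj.
(* For [m = 0] the two neighbours coincide, so the weights are added. *)
pose v' (i : 'I_m.+1) := v (widen i) +
  ((if i == ord_max then t else 0) + (if i == ord0 then 1 - t else 0)) *: v ord_max.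
(* [v'] is the transpose of the interpolation [ext] applied to [v]. *)
have v'E k : fdot v' k = fdot v (ext k).
  have pick (j : 'I_m.+1) (a : R) (F : 'I_m.+1 -> R) :
      \sum_i (if i == j then a else 0) * F i = a * F j.
    by rewrite (bigD1 j)//= eqxx big1 ?addr0// => i /negPf ->; rewrite mul0r.
  rewrite [RHS]/fdot big_ord_recr /= extM dotDr !dotZr.
  rewrite -(pick ord_max t (fun i => dot (v ord_max) (k i))).
  rewrite -(pick ord0 (1 - t) (fun i => dot (v ord_max) (k i))) -!big_split /=.
  apply: eq_bigr => i _; rewrite /v' dotDl dotZl mulrDl; congr (_ + _).
  by rewrite -[widen_ord _ _]/(widen i) extW.
have qE : q = ext (fun i => q (widen i)).
  apply/funext => i; have [j ->|->] := unliftP ord_max i.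
    rewrite (_ : lift ord_max j = widen j) ?extW//.
    by apply: ord_inj; rewrite lift_max.
  by rewrite extM /= qmax widen0.
exists (fun i => q (widen i)), v'; split; last first.
  rewrite /ellT big_ord_recr [leRHS]big_ord_recr [X in _ <= X + _]big_ord_recr /=.
  rewrite -addrA lerD//.
    rewrite le_eqVlt; apply/orP; left; apply/eqP; apply: eq_bigr => i _.
    congr (g (q _ - q _)); apply: val_inj => //=.
    by rewrite !modn_small// ltnS ?(ltn_ord i)// ltnW// ltnS.
  rewrite (_ : cyc_succ ord_max = ord0); last by apply: val_inj; rewrite /= modnn.
  rewrite (_ : cyc_succ (widen_ord _ _) = ord_max); last first.
    by apply: val_inj; rewrite /= modn_small.
  rewrite (_ : cyc_succ ord_max = ord0); last by apply: val_inj; rewrite /= modnn.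
  rewrite widen0 -[widen_ord _ _]/(widen ord_max) addrC.
  by apply: le_trans (gaugeD bT _ _); rewrite addrA subrK.
split; last by rewrite v'E -qE.
split=> [|k Kk].
  (* The square of the sum pairs [v'] with a constant family, which [ext] keeps constant and [v]
     annihilates. *)
  set x := \sum_i v' i; apply: dot_eq0.
  have -> : dot x x = fdot v' (fun=> x) by rewrite {1}/x dot_suml.
  rewrite v'E (_ : ext _ = fun=> 0 + x).
    by rewrite (fdot_translate (fun=> 0))// /fdot big1// => i _; exact: dot0r.
  apply/funext => i; rewrite /ext; case: insubP => [u _ _|_] /=.
    by rewrite add0r.
  by rewrite -scalerDl addrC subrK scale1r add0r.
rewrite v'E; apply: vK => i; rewrite /ext; case: insubP => [u _ _|_] /=.
  exact: Kk.
by case: bK => _ [cK _]; exact: cK.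
Qed.

Lemma delete_vertex m (q v : 'I_m.+2 -> 'rV[R]_n) j : blocks K v q ->
  segment (q (cyc_pred j)) (q (cyc_succ j)) (q j) ->
  exists q' v' : 'I_m.+1 -> 'rV[R]_n, blocks K v' q' /\ ellT T q' <= ellT T q.
Proof.
move=> vq [t [t01 qj]]; pose c := j - ord_max.
have Ej : ord_max + c = j by rewrite /c addrC subrK.
have pred_c : widen ord_max + c = cyc_pred j.
  apply: (@ordS_inj m.+2); rewrite [RHS]ord_predK -[LHS]/(cyc_succ _) cyc_succ_add -Ej.
  congr (_ + c).
  by apply: val_inj; rewrite /= modn_small.
have succ_c : ord0 + c = cyc_succ j.
  by rewrite -Ej cyc_succ_add; congr (_ + c); apply: val_inj; rewrite /= modnn.
have [|q' [v' [v'q' le]]] := delete_last_vertex (blocks_rotate c vq) t01.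
  by rewrite Ej pred_c succ_c.
by exists q', v'; rewrite -(ellT_rotate q c).
Qed.

End Reduction.

(** * From blocked curves to billiard trajectories, and rigidity *)

Section Billiards.
Variables (R : realType) (n : nat) (K T : set 'rV[R]_n).
Hypotheses (bK : convex_body K) (bT : convex_body T).
Hypotheses (scT : strictly_convex T) (smT : smooth_body T).

Lemma closed_polygon_translate m (q : 'I_m -> 'rV[R]_n) x :
  closed_polygon q -> closed_polygon (fun j => q j + x).
Proof.
move=> [m2 qq]; split=> // j; have [qj nseg] := qq j; split.
  by rewrite (inj_eq (addIr x)).
move=> [t [t01 E]]; apply: nseg; exists t; split=> //; apply: (addIr x).
by rewrite E; apply/rowP => i; rewrite !mxE; ring.
Qed.

Lemma normal_bd (C : set 'rV[R]_n) z u : C z -> normal_cone C z u -> u != 0 -> bd C z.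
Proof.
move=> Cz Nu u0; split; first exact: subset_closure.
by move=> /interior_normal_cone/(_ Nu)/eqP; apply/negP.
Qed.

Lemma blocks_perturb m (q v w : 'I_m -> 'rV[R]_n) (e : R) : blocks K v q ->
  0 <= fdot v w -> 0 <= e -> blocks K v (fun j => q j + e *: w j).
Proof.
by move=> [cv vq] vw e0; split=> //; rewrite fdot_comb (le_trans vq)// lerDl mulr_ge0.
Qed.

Lemma blocks_neq0 m (q v : 'I_m -> 'rV[R]_n) : blocks K v q -> exists j, v j != 0.
Proof.
move=> [_ vq]; apply/existsP; apply: contraPT vq => /existsPn v0.
rewrite /fdot big1 ?ler10// => j _.
by have /negPn/eqP -> := v0 j; exact: dot0l.
Qed.

Lemma minimizer_billiard m (q v : 'I_m -> 'rV[R]_n) : closed_polygon q ->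
  blocks K v q ->
  (forall q' v' : 'I_m -> 'rV[R]_n, blocks K v' q' -> ellT T q <= ellT T q') ->
  exists x, billiard_traj K T (fun j => q j + x).
Proof.
move=> cq vq qmin; have [_ qq] := cq; have [j0 vj0] := blocks_neq0 vq.
have [p pmax] := choice (fun j => gauge_max bT (q (cyc_succ j) - q j)).
have Tp j : T (p j) by case: (pmax j).
have Np j : normal_cone T (p j) (q (cyc_succ j) - q j) by case: (pmax j).
have u0 j : q (cyc_succ j) - q j != 0 by rewrite subr_eq0 eq_sym; case: (qq j).
have [s s0 ps] := first_order_condition bT scT (fun j => proj1 (qq j)) Tp Np vj0
  (fun w vw e e0 => qmin _ _ (blocks_perturb vq vw (ltW e0))).
have bp j : bd T (p j) by exact: normal_bd (Tp j) (Np j) (u0 j).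
(* Smoothness of [T] makes every jump of [p] nonzero; this later places all vertices on the boundary
   of [K]. *)
have v0 j : v j != 0.
  apply: contraNneq (billiard_normals_distinct j bT smT cq bp Np) => vj.
  by rewrite ps vj scaler0.
have [[x Kx]|[v' cv' v'q]] := translate_or_block bK q; last first.
  (* Dividing the curve by [fdot v' q > 1] keeps it blocked but shortens it, as its length is
     positive. *)
  have b0 : 0 < fdot v' q by exact: lt_trans v'q.
  have : ellT T q <= ellT T (fun j => (fdot v' q)^-1 *: q j).
    by apply: (qmin _ v'); split=> //; rewrite fdotZr mulVf// gt_eqF.
  rewrite (ellT_scale bT) ?invr_ge0 ?(ltW b0)// mulrC ler_pdivlMr// leNgt.
  rewrite -[X in X < _]mulr1 ltr_pM2l ?v'q//.
  exact: lt_le_trans (gauge_gt0 bT (u0 j0)) (gauge_le_ellT bT q j0).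
(* The translated curve lies in [K ^ m] and attains the bound of the certificate; replacing its
   single vertex [j] by [y] cannot increase the pairing. *)
have Nv j : normal_cone K (q j + x) (v j).
  move=> y Ky; have [[sv vK] vq1] := vq.
  have /vK : forall i, K (if i == j then y else q i + x) by move=> i; case: ifP.
  move=> /le_trans/(_ vq1); rewrite -(fdot_translate q x sv) /fdot.
  rewrite (bigD1 j)//= eqxx [leRHS](bigD1 j)//= dotBr subr_le0.
  by under eq_bigr => i /negPf -> do []; rewrite lerD2r.
exists x; split; first exact: closed_polygon_translate.
split; first by move=> j; exact: normal_bd (Kx j) (Nv j) (v0 j).
exists p => j; split=> //; split; first by rewrite opprD addrACA subrr addr0.
rewrite opprB; have := ps (cyc_succ j); rewrite {1}/cyc_pred ordSK => ->.
exact: normal_coneZ.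
Qed.

Lemma blocks_billiard m (q v : 'I_m -> 'rV[R]_n) : blocks K v q ->
  exists m' (q' : 'I_m' -> 'rV[R]_n), billiard_traj K T q' /\ ellT T q' <= ellT T q.
Proof.
elim: m q v => [|m IH] q v vq; first by have [[]] := blocks_neq0 vq.
case: m => [|m] in q v vq IH *.
  (* A single vector with zero sum vanishes, so a blocked curve has at least two vertices. *)
  have [j] := blocks_neq0 vq; rewrite (ord1 j).
  by case: vq => -[]; rewrite big_ord1 => ->; rewrite eqxx.
have [q1 [v1 [v1q1 q1min]]] := ellT_minimizer bK bT vq.
have q1q := q1min _ _ vq.
have [[j seg]|nseg] := pselect (exists j, segment (q1 (cyc_pred j)) (q1 (cyc_succ j)) (q1 j)).
  have [q' [v' [v'q' le']]] := delete_vertex bK bT v1q1 seg.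
  have [m'' [q'' [bq'' le'']]] := IH _ _ v'q'.
  by exists m'', q''; split=> //; rewrite (le_trans le'')// (le_trans le').
have cq1 : closed_polygon q1.
  split=> // j; split; last by move=> seg; apply: nseg; exists j.
  (* Equal consecutive vertices are a degenerate instance of the segment condition, with parameter
     [0]. *)
  apply/negP => /eqP E; apply: nseg; exists j, 0; split; first by rewrite lexx ler01.
  by rewrite -E scale0r add0r subr0 scale1r.
have [x bq] := minimizer_billiard cq1 v1q1 q1min.
by exists m.+2, (fun j => q1 j + x); split=> //; rewrite ellT_translate.
Qed.

(** Since each [v j] is normal at [q j], the curve maximizes [fdot v] over [K ^ m], and dividing [v]
    by the maximum [b] gives a certificate blocking [q]. *)
Lemma minimizing_normals_unique m (q p v : 'I_m -> 'rV[R]_n) j0 :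
  ellT_minimizing K T q -> billiard_witness K T q p ->
  (forall j, normal_cone K (q j) (v j)) -> \sum_j v j = 0 -> v j0 != 0 ->
  exists2 s, 0 < s & forall j, p (cyc_pred j) - p j = s *: v j.
Proof.
move=> [[cq [bq _]] qmin] pw Nv v0 vj0; have [_ qq] := cq.
have cK : compact K by case: bK.
have cT : compact T by case: bT.
have Kq j : K (q j) by exact: compact_bd_mem (bq j).
have Tp j : T (p j) by apply: compact_bd_mem; case: (pw j).
have Np j : normal_cone T (p j) (q (cyc_succ j) - q j) by case: (pw j) => _ [].
have vmax k : (forall j, K (k j)) -> fdot v k <= fdot v q.
  move=> Kk; apply: ler_sum => j _.
  by have := Nv j _ (Kk j); rewrite dotBr subr_le0.
pose b := fdot v q; have b0 : 0 < b := support_gt0 bK vj0 vmax.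
have vq : blocks K (fun j => b^-1 *: v j) q.
  split; first exact: (normal_certificate_scale bK v0 vj0 vmax).
  by rewrite fdotZl mulVf// gt_eqF.
have [|w vw e e0|s s0 ps] :=
    first_order_condition (v := fun j => b^-1 *: v j) (j0 := j0) bT scT
      (fun j => proj1 (qq j)) Tp Np.
- by rewrite scaler_eq0 negb_or vj0 andbT invr_eq0 gt_eqF.
(* The perturbed curve may leave [K], but it is still blocked, hence no shorter than some
   trajectory. *)
- have [m' [q' [bq' le']]] := blocks_billiard (blocks_perturb vq vw (ltW e0)).
  exact: le_trans (qmin _ _ bq') le'.
exists (s / b) => [|j]; last by rewrite ps scalerA.
rewrite divr_gt0// lt_neqAle s0 andbT eq_sym.
apply: contraNneq (billiard_normals_distinct j0 bT smT cq (fun j => proj1 (pw j)) Np).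
by move=> s00; rewrite ps s00 scale0r.
Qed.

End Billiards.

(** * Cones spanned by vectors with a positive linear relation *)

Section PositiveRelation.
Variables (R : realType) (n m : nat) (e : 'I_m -> 'rV[R]_n) (mu : 'I_m -> R).
Hypotheses (mu_gt0 : forall j, 0 < mu j) (rel : \sum_j mu j *: e j = 0).

Lemma positive_shift (lam : 'I_m -> R) : exists t, forall j, 0 < lam j + t * mu j.
Proof.
(* The term of index [j] absorbs [lam j], and the 1 leaves a surplus [mu j]. *)
exists (1 + \sum_i `|lam i| / mu i) => j.
have H0 i : 0 <= `|lam i| / mu i by rewrite divr_ge0// ltW.
rewrite (bigD1 j)//= addrA mulrDl mulrDl divfK ?gt_eqF// mul1r.
have S0 : 0 <= (\sum_(i < m | i != j) `|lam i| / mu i) * mu j.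
  by rewrite mulr_ge0 ?sumr_ge0// ltW.
have := ler_norm (- lam j); rewrite normrN.
by have := mu_gt0 j; lra.
Qed.

Lemma relation_shift (lam : 'I_m -> R) t :
  \sum_j (lam j + t * mu j) *: e j = \sum_j lam j *: e j.
Proof.
under eq_bigr do rewrite scalerDl -scalerA.
by rewrite big_split /= -scaler_sumr rel scaler0 addr0.
Qed.

(** Adding a multiple of the positive relation makes all coefficients positive without changing the
    sum, so the cone is the linear span. *)
Lemma cone_span_comb (lam : 'I_m -> R) : cone_span e (\sum_j lam j *: e j).
Proof.
have [t lt] := positive_shift lam.
exists (fun j => lam j + t * mu j); rewrite relation_shift; split=> // j.
exact: ltW.
Qed.

Lemma cone_span_subspace : linear_subspace (cone_span e).
Proof.
split; first by exists (fun=> 0); split=> //; rewrite big1// => j _; rewrite scale0r.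
split=> [_ _ [l [_ ->]] [l' [_ ->]]|a _ [l [_ ->]]].
  by rewrite -big_split /=; under eq_bigr do rewrite -scalerDl; exact: cone_span_comb.
by rewrite scaler_sumr; under eq_bigr do rewrite scalerA; exact: cone_span_comb.
Qed.

Lemma cone_span_gen j : cone_span e (e j).
Proof.
exists (fun i => (i == j)%:R); split=> [i|]; first exact: ler0n.
rewrite (bigD1 j)//= eqxx scale1r big1 ?addr0// => i /negPf ->.
by rewrite scale0r.
Qed.

End PositiveRelation.

(** * Dimension counts from rigidity *)

Theorem theorem1p3 (R : realType) (n : nat) (K T : set 'rV[R]_n)
  (m : nat) (q : 'I_m -> 'rV[R]_n)
  (H : 'I_m -> set 'rV[R]_n) (nK : 'I_m -> 'rV[R]_n) (mu : 'I_m -> R) :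
  convex_body K -> convex_body T -> strictly_convex T -> smooth_body T ->
  ellT_minimizing K T q ->
  (forall j, supporting_hyperplane K (q j) (H j)) ->
  (forall j, normal_cone K (q j) (nK j) /\ dot (nK j) (nK j) = 1 /\
             H j = [set x | dot (nK j) x = dot (nK j) (q j)]) ->
  (forall j, 0 <= mu j) ->
  (exists p, billiard_witness K T q p /\
     forall j, p (cyc_succ j) - p j = - (mu (cyc_succ j) *: nK (cyc_succ j))) ->
  linear_subspace (cone_span nK) /\ span_dim (cone_span nK) m.-1 /\ (m <= n.+1)%N /\
  (forall j, span_dim (normal_cone K (q j) `&` cone_span nK) 1).
Proof.
move=> bK bT scT smT qmin _ nKE mu_ge0 [p [pw pmu]].
have NnK j : normal_cone K (q j) (nK j) by case: (nKE j).
have nK1 j : dot (nK j) (nK j) = 1 by case: (nKE j) => _ [].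
have nK0 j : nK j != 0.
  by apply/eqP => nKj; have /eqP := nK1 j; rewrite nKj dot0l eq_sym oner_eq0.
have aE j : p (cyc_pred j) - p j = mu j *: nK j.
  by have := pmu (cyc_pred j); rewrite /cyc_succ ord_predK -opprB => /oppr_inj.
have [[cq _] _] := qmin.
have mu_gt0 j : 0 < mu j.
  rewrite lt_neqAle mu_ge0 andbT eq_sym.
  have := billiard_normals_distinct j bT smT cq (fun j => proj1 (pw j))
    (fun j => proj1 (proj2 (pw j))).
  by rewrite aE scaler_eq0 negb_or => /andP[].
have rel : \sum_j mu j *: nK j = 0.
  by rewrite -[RHS](sum_cyc_diff p); apply: eq_bigr => j _; rewrite aE.
have key v j0 (Nv : forall j, normal_cone K (q j) (v j)) (v0 : \sum_j v j = 0)
    (vj0 : v j0 != 0) : exists2 s, 0 < s & forall j, mu j *: nK j = s *: v j.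
  have [s s0 E] := minimizing_normals_unique bK bT scT smT qmin pw Nv v0 vj0.
  by exists s => // j; rewrite -aE.
split; first exact: cone_span_subspace.
case: cq => m2 _.
case: m m2 => [|[|m]] // _
  in q H nK mu qmin nKE mu_ge0 p pw pmu NnK nK1 nK0 aE mu_gt0 rel key *.
(* The positive relation expresses the omitted first normal through the others. *)
pose b (i : 'I_m.+1) := nK (lift ord0 i).
have free_b : row_free (\matrix_i b i).
  apply: inj_row_free => c; rewrite mulmx_sum_row => c0.
  (* Shifted to positive coefficients, this relation is proportional to [mu] by rigidity; its zero
     entry at [ord0] gives [s * t = 1], and then every [c ord0 i] vanishes. *)
  pose lam j := if unlift ord0 j is Some i then c ord0 i else 0.
  have lam0 : \sum_j lam j *: nK j = 0.
    rewrite big_ord_recl /lam unlift_none scale0r add0r -[RHS]c0.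
    by apply: eq_bigr => i _; rewrite liftK rowK.
  have [t lt] := positive_shift mu_gt0 lam.
  have [|||s s0 E] := @key (fun j => (lam j + t * mu j) *: nK j) ord0.
  - by move=> j; apply: normal_coneZ => //; exact: ltW.
  - by rewrite relation_shift.
  - by rewrite scaler_eq0 negb_or nK0 andbT gt_eqF.
  have {}E j : mu j = s * (lam j + t * mu j).
    have := congr1 (fun x => dot x (nK j)) (E j).
    by rewrite !dotZl nK1 !mulr1.
  have st : s * t = 1.
    have := E ord0; rewrite /lam unlift_none add0r mulrA -{1}[mu _]mul1r.
    by move/(mulIf (negbT (gt_eqF (mu_gt0 _)))).
  apply/rowP => i; rewrite mxE; have := E (lift ord0 i).
  rewrite mulrDr mulrA st mul1r /lam liftK -{1}[mu _]add0r => /addIr/esym/eqP.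
  by rewrite mulf_eq0 gt_eqF//= => /eqP.
have b_sub i : (b i <= \matrix_i b i)%MS by rewrite -[b i](rowK b) row_sub.
split; last split.
- exists b; split; first by move=> i; exact: cone_span_gen.
  split=> // _ [lam [_ ->]]; apply: summx_sub => j _; apply: scalemx_sub.
  have [i ->|->] := unliftP ord0 j; first exact: b_sub.
  have : mu ord0 *: nK ord0 = - \sum_i mu (lift ord0 i) *: b i.
    by apply/eqP; rewrite -addr_eq0; apply/eqP; rewrite -[RHS]rel [in RHS]big_ord_recl.
  move=> /(congr1 (fun x => (mu ord0)^-1 *: x)); rewrite scalerK ?gt_eqF// => ->.
  apply: scalemx_sub; rewrite eqmx_opp; apply: summx_sub => i _.
  exact: scalemx_sub.
- by have := free_b; rewrite /row_free => /eqP <-; rewrite ltnS rank_leq_col.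
- move=> j; exists (fun=> nK j); split; first by move=> _; split=> //; exact: cone_span_gen.
  split.
    apply: inj_row_free => c; rewrite mulmx_sum_row big_ord1 rowK => /eqP.
    rewrite scaler_eq0 (negPf (nK0 j)) orbF => /eqP c0.
    by apply/rowP => i; rewrite (ord1 i) mxE.
  move=> x [Nx Ux]; have [_ [_ /(_ (-1) _ Ux)]] := cone_span_subspace mu_gt0 rel.
  rewrite scaleN1r => -[lam [lam0 xE]].
  (* The coefficients [lam] represent [- x], so adding [x] at [j] restores a zero sum of normals. *)
  pose v i := (lam i + 1 * mu i) *: nK i + (if i == j then x else 0).
  have lmu i : 0 < lam i + 1 * mu i by rewrite mul1r ltr_wpDl.
  (* The entry at [j] might cancel; its neighbour is unaffected by [x] and visibly nonzero. *)
  have [|||s s0 E] := @key v (cyc_succ j).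
  + move=> i; apply: normal_coneD; first by apply: normal_coneZ => //; exact: ltW.
    by case: eqP => [->//|_]; exact: normal_cone0.
  + rewrite big_split /= relation_shift// -xE (bigD1 j)//= eqxx big1.
      by rewrite addr0 addNr.
    by move=> i /negPf ->.
  + have /negPf nj : cyc_succ j != j.
      have [[[_ /(_ j)[+ _]] _] _] := qmin.
      by apply: contraNneq => ->.
    by rewrite /v nj addr0 scaler_eq0 negb_or nK0 andbT gt_eqF.
  have {}E := E j; rewrite /v eqxx in E.
  have -> : x = (s^-1 * mu j - (lam j + 1 * mu j)) *: nK j.
    by rewrite scalerBl -scalerA E scalerK ?gt_eqF// addrC addKr.
  apply: scalemx_sub; rewrite -[X in (X <= _)%MS](rowK (fun _ : 'I_1 => nK j) ord0).
  exact: row_sub.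
Qed.
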